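(* Let $(\mathcal{X},d)$ be a metric space, let $S\subseteq\mathcal{X}$ be a finite set, let $n_0\ge 1$ be an integer with $n_0<|S|$, and let $\tilde c$ be the strong expansion rate of $S$ (with respect to $n_0$). Let $q\in\mathcal{X}$ have a unique nearest neighbor $x_q$ in $S$. Suppose there exist constants $C>0$ and $\alpha\in(0,1]$ such that for every $A\in\mathcal{C}_S$ containing $x_q$ and for all $x\in A\setminus\{x_q\}$, $$\left|B\big(q,\,d(q,x)+2d(q,x_q)\big)\cap A\right|\le \left|B^{\circ}\big(q,\,d(q,x)\big)\cap A\right|+C|A|^{1-\alpha}.$$ Let $\hat x_q$ be the element returned by the nearest neighbor search for $q$ on the random comparison tree constructed from $S$ with maximum leaf size $n_0$. Then $$\mathsf{P}\left(\hat x_q\ne x_q\right)\le \frac{360\,C\,\tilde c^{2}}{\alpha}\,n_0^{-\alpha},$$ where the probability is with respect to the random construction of the tree.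
   Context: $B(x,r)$ and $B^{\circ}(x,r)$ denote the closed and open balls in $(\mathcal{X},d)$ with center $x$ and radius $r$. Comparison tree construction (input: finite set $S$, maximum leaf size $n_0$). The root is $S$. A node $A$ with $|A|\le n_0$ is a leaf. A node $A$ with $|A|>n_0$ is split: an ordered pair of distinct points $x_1,x_2\in A$ (left and right pivot) is drawn uniformly at random, the left child is $\{x\in A: d(x,x_1)\le d(x,x_2)\}$ and the right child is the remaining set $\{x\in A: d(x,x_1)>d(x,x_2)\}$; the procedure recurses on both children, with independent randomness. Nearest neighbor search for a query $q\in\mathcal{X}$. Start at the root. At a non-leaf node with pivots $x_1$ (left) and $x_2$ (right), go to the left child if $d(q,x_1)\le d(q,x_2)$ and to the right child otherwise. On reaching a leaf, return an element $\hat x_q$ of the leaf with $d(q,\hat x_q)\le d(q,x)$ for all $x$ in the leaf. The collection $\mathcal{C}_S$. Take the smallest collection of subsets of $S$ such that (1) $S$ belongs to it; (2) for all $x,y\in S$, the set $A=\{z\in S: d(z,x)\le d(z,y)\}$ and its complement $S\setminus A$ belong to it; (3) it is closed under pairwise intersections. Then remove all sets with at most $n_0$ elements; the result is $\mathcal{C}_S$. Strong expansion rate. The strong expansion rate of $S$ is the smallest $\tilde c\ge 1$ such that $|B(x,2r)\cap A|\le \tilde c\,|B(x,r)\cap A|$ for all $A\in\mathcal{C}_S$, all $x\in A$ and all $r>0$. *)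

(* Defs.v *)
From HB Require Import structures.
From mathcomp Require Export all_boot all_order all_algebra.
From mathcomp Require Export finmap.
From mathcomp Require Export all_classical all_reals all_analysis.

Set Implicit Arguments.
Unset Strict Implicit.
Unset Printing Implicit Defensive.

Import Order.TTheory GRing.Theory Num.Theory.
Local Open Scope fset_scope.
Local Open Scope ring_scope.

(* Closed and open balls, intersected with a finite set [A]; the radius may be
   any real. (The library's [closed_ball] is the closure of the open ball,
   which can be strictly smaller than [{y | d x y <= r}] in a metric space.) *)
Definition cballI (R : realType) (X : metricType R) (x : X) (r : R)
    (A : {fset X}) : {fset X} :=
  [fset y in A | mdist x y <= r].

Definition oballI (R : realType) (X : metricType R) (x : X) (r : R)
    (A : {fset X}) : {fset X} :=
  [fset y in A | mdist x y < r].

Definition left_part (R : realType) (X : metricType R) (x1 x2 : X)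
    (A : {fset X}) : {fset X} :=
  [fset z in A | mdist z x1 <= mdist z x2].

Definition right_part (R : realType) (X : metricType R) (x1 x2 : X)
    (A : {fset X}) : {fset X} :=
  [fset z in A | mdist z x2 < mdist z x1].

Inductive split_closure (R : realType) (X : metricType R) (S : {fset X}) :
    {fset X} -> Prop :=
| SplitRoot : split_closure S S
| SplitHalf x y : x \in S -> y \in S -> split_closure S (left_part x y S)
| SplitHalfC x y : x \in S -> y \in S ->
    split_closure S (S `\` left_part x y S)
| SplitI A B : split_closure S A -> split_closure S B ->
    split_closure S (A `&` B).

(* The collection C_S. *)
Definition split_collection (R : realType) (X : metricType R) (S : {fset X})
    (n0 : nat) (A : {fset X}) : Prop :=
  split_closure S A /\ (n0 < #|` A|)%N.

Definition expansion_bound (R : realType) (X : metricType R) (S : {fset X})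
    (n0 : nat) (c : R) : Prop :=
  1 <= c /\
  forall A, split_collection S n0 A -> forall x, x \in A -> forall r, 0 < r ->
    #|` cballI x (2 * r) A|%:R <= c * #|` cballI x r A|%:R.

Definition is_strong_expansion_rate (R : realType) (X : metricType R)
    (S : {fset X}) (n0 : nat) (c : R) : Prop :=
  expansion_bound S n0 c /\ forall c', expansion_bound S n0 c' -> c <= c'.

Definition is_unique_nn (R : realType) (X : metricType R) (S : {fset X})
    (q xq : X) : Prop :=
  xq \in S /\ forall x, x \in S -> x != xq -> mdist q xq < mdist q x.

(* [Node x1 x2 l r]: left pivot, right pivot, left subtree, right subtree. *)
Inductive ctree (X : choiceType) : Type :=
| Leaf of {fset X}
| Node of X & X & ctree X & ctree X.

HB.instance Definition _ (X : choiceType) := gen_eqMixin (ctree X).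
HB.instance Definition _ (X : choiceType) := gen_choiceMixin (ctree X).

(* Probability that the random construction, started at the node [A], yields
   exactly the tree [t]: at each split the ordered pair of distinct pivots has
   probability 1 / (|A| (|A| - 1)), and the two subtrees are independent. *)
Fixpoint ctree_pmf (R : realType) (X : metricType R) (n0 : nat)
    (A : {fset X}) (t : ctree X) : R :=
  match t with
  | Leaf B => ((#|` A| <= n0)%N && (B == A))%:R
  | Node x1 x2 l r =>
      if [&& (n0 < #|` A|)%N, x1 \in A, x2 \in A & x1 != x2] then
        (#|` A| * (#|` A|).-1)%:R^-1
        * (ctree_pmf n0 (left_part x1 x2 A) l
           * ctree_pmf n0 (right_part x1 x2 A) r)
      else 0
  end.

(* The law of the random comparison tree built from [S]. *)
Definition ctree_prob (R : realType) (X : metricType R) (n0 : nat)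
    (S : {fset X}) (E : set (ctree X)) : \bar R :=
  (\esum_(t in E) (ctree_pmf n0 S t)%:E)%E.

Fixpoint search_leaf (R : realType) (X : metricType R) (q : X)
    (t : ctree X) : {fset X} :=
  match t with
  | Leaf B => B
  | Node x1 x2 l r =>
      if mdist q x1 <= mdist q x2 then search_leaf q l else search_leaf q r
  end.

(* [x] is an admissible output of the search for [q] in [t]; ties inside the
   leaf may be broken arbitrarily. *)
Definition nn_search_output (R : realType) (X : metricType R) (q : X)
    (t : ctree X) (x : X) : Prop :=
  x \in search_leaf q t /\
  forall y, y \in search_leaf q t -> mdist q x <= mdist q y.

(* Main.v *)
Require Import Defs.
From mathcomp Require Import ring lra.

Set Implicit Arguments.
Unset Strict Implicit.
Unset Printing Implicit Defensive.

Import Order.TTheory GRing.Theory Num.Theory.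
Local Open Scope fset_scope.
Local Open Scope ring_scope.

(* The search fails only if some node A on the path of [xq] has pivots sending
   [q] and [xq] to different children. The pivots then have distances to [q]
   differing by at most 2 d(q, xq), and the nearer one is not [xq], so the ball
   hypothesis makes the probability of this at most 4 C |A|^-alpha.
   On the other hand, for each pivot v, three quarters of the other pivots u are
   so far from v that the ball of radius d(u, v) / 4 around v, all of which goes
   to the child of v, has at least |A| / (4 c^2) points. So with probability at
   least 1/2 both children have at most (1 - 1 / (4 c^2)) |A| points, and the
   potential K (2 n0^-alpha - |A|^-alpha) drops enough on average to pay for the
   failure probability at A. *)

(** * Finite sums over trees and means over pivot pairs *)

Section SumsOverTrees.
Variables (R : realType) (X : metricType R) (n0 : nat).
Implicit Types (A : {fset X}) (J : {fset ctree X}) (t : ctree X).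

Lemma ler_term_sum (T : eqType) (s : seq T) (F : T -> R) x :
  (forall y, 0 <= F y) -> x \in s -> F x <= \sum_(y <- s) F y.
Proof.
move=> F0 xs; rewrite (big_rem x)//= lerDl; exact: sumr_ge0.
Qed.

Lemma sum_delta_le (T : choiceType) (J : {fset T}) (u : T) (F : T -> R) :
  (forall y, 0 <= F y) -> \sum_(t <- J) (t == u)%:R * F t <= F u.
Proof.
move=> F0; have [uJ|uJ] := boolP (u \in J).
  rewrite (big_fsetD1 u)//= eqxx mul1r big_seq big1 ?addr0// => t.
  by rewrite in_fsetD1 => /andP[/negPf-> _]; rewrite mul0r.
rewrite big_seq big1// => t tJ; have /negPf-> : t != u.
  by apply: contraNneq uJ => <-.
by rewrite mul0r.
Qed.

(** The value at a leaf is a dummy: it can only add nonnegative terms to sums over the image of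
    [J]. *)
Definition lsubtree t := if t is Node _ _ l _ then l else t.
Definition rsubtree t := if t is Node _ _ _ r then r else t.

(** Each node of [J] contributing to the left side reappears on the right, since its subtrees lie in
    the two images; all further terms are nonnegative. The delta in [G] lets the sum over [J] move
    innermost, where it collapses to one tree. *)
Lemma sum_ctree_le J A (g : ctree X -> R) :
  (forall t, 0 <= g t) -> (forall B, g (Leaf B) = 0) ->
  (forall x1 x2 l r, ~~ ((x1 \in A) && (x2 \in A)) -> g (Node x1 x2 l r) = 0) ->
  \sum_(t <- J) g t <=
  \sum_(x1 <- A) \sum_(x2 <- A) \sum_(l <- lsubtree @` J)
    \sum_(r <- rsubtree @` J) g (Node x1 x2 l r).
Proof.
move=> g0 gL gN.
pose G x1 x2 l r t := (t == Node x1 x2 l r)%:R * g t.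
have G0 x1 x2 l r t : 0 <= G x1 x2 l r t by rewrite mulr_ge0.
have gG t : t \in J -> g t <= \sum_(x1 <- A) \sum_(x2 <- A)
    \sum_(l <- lsubtree @` J) \sum_(r <- rsubtree @` J) G x1 x2 l r t.
  move=> tJ; case: t tJ => [B|x1 x2 l r] tJ.
    by rewrite gL; do 4![apply: sumr_ge0 => ? _].
  have [/andP[x1A x2A]|/gN->] := boolP ((x1 \in A) && (x2 \in A)); last first.
    by do 4![apply: sumr_ge0 => ? _].
  have lJ : l \in lsubtree @` J by apply/imfsetP; exists (Node x1 x2 l r).
  have rJ : r \in rsubtree @` J by apply/imfsetP; exists (Node x1 x2 l r).
  set t := Node x1 x2 l r.
  have -> : g t = G x1 x2 l r t by rewrite /G eqxx mul1r.
  apply: le_trans (ler_term_sum (F := fun r => G x1 x2 l r t) _ rJ) _ => //.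
  apply: le_trans (ler_term_sum (F := fun l => \sum_(r <- _) G x1 x2 l r t) _ lJ) _.
    by move=> ?; apply: sumr_ge0.
  apply: le_trans (ler_term_sum
    (F := fun x2 => \sum_(l <- _) \sum_(r <- _) G x1 x2 l r t) _ x2A) _.
    by move=> ?; do 2![apply: sumr_ge0 => ? _].
  apply: (ler_term_sum
    (F := fun x1 => \sum_(x2 <- _) \sum_(l <- _) \sum_(r <- _) G x1 x2 l r t)) => //.
  by move=> ?; do 3![apply: sumr_ge0 => ? _].
rewrite big_seq; apply: (le_trans (ler_sum _ gG)); rewrite -big_seq.
rewrite exchange_big; apply: ler_sum => x1 _.
rewrite exchange_big; apply: ler_sum => x2 _.
rewrite exchange_big; apply: ler_sum => l _.
rewrite exchange_big; apply: ler_sum => r _.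
exact: sum_delta_le.
Qed.

Lemma ctree_pmf_ge0 A t : 0 <= ctree_pmf n0 A t :> R.
Proof.
elim: t A => [B|x1 x2 l IHl r IHr] A /=; first by rewrite ler0n.
by case: ifP => // _; rewrite !mulr_ge0 ?invr_ge0.
Qed.

(** The expectation of [F] over a uniformly drawn ordered pair of distinct points of [A]. *)
Definition pivot_mean A (F : X -> X -> R) : R :=
  (#|` A| * (#|` A|).-1)%:R^-1 *
  \sum_(x1 <- A) \sum_(x2 <- A | x1 != x2) F x1 x2.

Lemma ler_pivot_mean A (F G : X -> X -> R) :
  {in A &, forall x1 x2, x1 != x2 -> F x1 x2 <= G x1 x2} ->
  pivot_mean A F <= pivot_mean A G.
Proof.
move=> FG; apply: ler_wpM2l; first by rewrite invr_ge0.
rewrite big_seq [leRHS]big_seq; apply: ler_sum => x1 x1A.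
rewrite big_seq_cond [leRHS]big_seq_cond; apply: ler_sum => x2 /andP[x2A x12].
exact: FG.
Qed.

Lemma pivot_meanD A (F G : X -> X -> R) :
  pivot_mean A (fun x1 x2 => F x1 x2 + G x1 x2) = pivot_mean A F + pivot_mean A G.
Proof.
rewrite /pivot_mean -mulrDr -big_split/=; congr (_ * _).
by apply: eq_bigr => x1 _; rewrite big_split.
Qed.

Lemma pivot_meanZ A k (F : X -> X -> R) :
  pivot_mean A (fun x1 x2 => k * F x1 x2) = k * pivot_mean A F.
Proof.
rewrite /pivot_mean mulrCA; congr (_ * _); rewrite mulr_sumr.
by apply: eq_bigr => x1 _; rewrite mulr_sumr.
Qed.

Lemma pivot_mean_sym A (F : X -> X -> R) :
  pivot_mean A (fun x1 x2 => F x2 x1) = pivot_mean A F.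
Proof.
rewrite /pivot_mean; congr (_ * _); under eq_bigr do rewrite big_mkcond.
rewrite exchange_big; apply: eq_bigr => x1 _; rewrite [RHS]big_mkcond.
by apply: eq_bigr => x2 _; rewrite eq_sym.
Qed.

(** One step of the recursion: condition on the root pivots, then the mass factors over the two
    subtrees. Enlarging [J] to a product of subtree sets makes this an inequality. *)
Lemma sum_ctree_pmf_le J A (f : ctree X -> R) :
  (n0 < #|` A|)%N -> (forall t, 0 <= f t) ->
  \sum_(t <- J) ctree_pmf n0 A t * f t <=
  pivot_mean A (fun x1 x2 => \sum_(l <- lsubtree @` J) \sum_(r <- rsubtree @` J)
    ctree_pmf n0 (left_part x1 x2 A) l * ctree_pmf n0 (right_part x1 x2 A) r
    * f (Node x1 x2 l r)).
Proof.
move=> An0 f0.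
apply: le_trans (sum_ctree_le J (A := A) _ _ _) _.
- by move=> t; rewrite mulr_ge0// ctree_pmf_ge0.
- by move=> B /=; rewrite leqNgt An0/= mul0r.
- move=> x1 x2 l r; rewrite negb_and => nA /=; rewrite ifF ?mul0r//.
  by case/orP: nA => /negPf->; rewrite ?andbF.
rewrite /pivot_mean mulr_sumr big_seq [leRHS]big_seq.
apply: ler_sum => x1 x1A; rewrite mulr_sumr [leRHS]big_mkcond/=.
rewrite big_seq [leRHS]big_seq; apply: ler_sum => x2 x2A.
rewrite An0 x1A x2A/=; have [->|x12]/= := eqVneq.
  by rewrite big1// => l _; rewrite big1// => r _; rewrite mul0r.
rewrite mulr_sumr ler_sum// => l _; rewrite mulr_sumr ler_sum// => r _.
by rewrite !mulrA.
Qed.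

End SumsOverTrees.

(** * Counting pivots: unbalanced splits, and splits separating [q] from [xq] *)

Section Counting.
Variables (R : realType) (X : metricType R).
Implicit Types (A : {fset X}).

Lemma sum_indicator_fset (T : choiceType) (A : {fset T}) (P Q : pred T) :
  \sum_(x <- A | P x) (Q x)%:R = #|` [fset x in A | P x && Q x]|%:R :> R.
Proof.
rewrite card_fset_sum1 natr_sum big_fset/= big_mkcondr/=.
by apply: eq_bigr => x _; case: (Q x).
Qed.

Lemma cardfs_rem (T : choiceType) (A : {fset T}) x : x \in A ->
  #|` [fset y in A | x != y]| = (#|` A|).-1.
Proof.
move=> xA; rewrite (cardfsD1 x A) xA/=; congr #|` _|.
by apply/fsetP => y; rewrite !inE/= andbC eq_sym.
Qed.

Lemma pivot_mean_indicator_le A (P : rel X) (k : R) : (1 < #|` A|)%N ->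
  {in A, forall x, #|` [fset y in A | (x != y) && P x y]|%:R <= k} ->
  pivot_mean A (fun x y => (P x y)%:R) <= k / (#|` A|).-1%:R.
Proof.
move=> A1 Pk; rewrite /pivot_mean.
have A0 : (0 < #|` A|)%N by exact: ltnW.
have A10 : (0 < (#|` A|).-1)%N by rewrite -ltnS prednK.
apply: (@le_trans _ _ ((#|` A| * (#|` A|).-1)%:R^-1 * \sum_(x <- A) k)).
  apply: ler_wpM2l; rewrite ?invr_ge0//.
  rewrite big_seq [leRHS]big_seq; apply: ler_sum => x xA.
  by rewrite sum_indicator_fset Pk.
rewrite big_const_seq count_predT iter_addr_0 -(mulr_natr k) natrM.
rewrite le_eqVlt; apply/orP; left; apply/eqP; field.
by rewrite !pnatr_eq0 -!lt0n A0 A10.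
Qed.

Lemma pivot_mean_cst A k : (1 < #|` A|)%N -> pivot_mean A (fun _ _ => k) = k.
Proof.
move=> A1; have A0 : (0 < #|` A|)%N by exact: ltnW.
have A10 : (0 < (#|` A|).-1)%N by rewrite -ltnS prednK.
rewrite -[in LHS](mulr1 k) (pivot_meanZ A k (fun _ _ => 1)) -[RHS]mulr1; congr (_ * _).
rewrite /pivot_mean big_seq (eq_bigr (fun=> (#|` A|).-1%:R)); last first.
  move=> x xA; rewrite (sum_indicator_fset A _ predT)/= -(cardfs_rem xA).
  by congr (#|` _|%:R); apply/fsetP => y; rewrite !inE/= andbT.
rewrite -big_seq big_const_seq count_predT iter_addr_0 -(mulr_natl _%:R) -natrM.
by rewrite mulVf// pnatr_eq0 -lt0n muln_gt0 A0.
Qed.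

Lemma right_partE x1 x2 A : right_part x1 x2 A = A `\` left_part x1 x2 A.
Proof.
apply/fsetP => z; rewrite !inE/= ltNge; case: (z \in A) => //=.
by rewrite andbT.
Qed.

Lemma cardfs_parts x1 x2 A :
  (#|` left_part x1 x2 A| + #|` right_part x1 x2 A|)%N = #|` A|.
Proof.
rewrite right_partE -(cardfsID (left_part x1 x2 A) A); congr (_ + _)%N.
by congr #|` _|; apply/fsetP => z; rewrite !inE/= andbA andbb.
Qed.

Lemma sub_right_left_part x1 x2 A : right_part x2 x1 A `<=` left_part x1 x2 A.
Proof.
by apply/fsubsetP => z; rewrite !inE/= => /andP[-> /ltW->].
Qed.

Lemma parts_lt x1 x2 A : x1 \in A -> x2 \in A -> x1 != x2 ->
  (#|` left_part x1 x2 A| < #|` A|)%N /\ (#|` right_part x1 x2 A| < #|` A|)%N.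
Proof.
move=> x1A x2A x12; rewrite -!(cardfs_parts x1 x2 A) -[X in (X < _)%N /\ _]addn0.
rewrite -[X in _ /\ (X < _)%N]add0n ltn_add2l ltn_add2r !cardfs_gt0.
split; apply/fset0Pn; [exists x2|exists x1]; rewrite !inE/= mdistxx.
  by rewrite x2A mdist_gt0 eq_sym.
by rewrite x1A mdist_ge0.
Qed.

(* The ball around [v] through the counted point [u0] farthest from [v], at
   distance [d], contains [v] and all the counted points, while the points of [A]
   within [d / 4] of [v] are all closer to [v] than to [u0]. *)
Lemma card_small_parts A (c : R) v : 0 < c ->
  (forall r, 0 < r -> #|` cballI v (2 * r) A|%:R <= c * #|` cballI v r A|%:R) ->
  v \in A ->
  #|` [fset u in A | (v != u) &&
       (#|` right_part u v A|%:R < #|` A|%:R / (4 * c ^+ 2))]|%:R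
    <= (#|` A|).-1%:R / 4 :> R.
Proof.
move=> c0 exp vA; set T := [fset u in A | _].
have [->|/fset0Pn[u1 u1T]] := eqVneq T fset0; first by rewrite cardfs0 divr_ge0.
have [[u0 u0T] _ umax] := @Order.TotalTheory.arg_maxP _ _ _ [` u1T] predT
  (fun u => mdist v (val u)) isT.
set d := mdist v u0.
move: (u0T); rewrite !inE/= => /and3P[u0A vu0 small].
have d0 : 0 < d by rewrite mdist_gt0.
(* Two doublings, from d / 4 to d / 2 and from d / 2 to d, give the factor c^2. *)
have dbl : #|` cballI v d A|%:R <= c ^+ 2 * #|` cballI v (d / 4) A|%:R.
  have /exp := divr_gt0 d0 (ltr0Sn R 1).
  have /exp := divr_gt0 d0 (ltr0Sn R 3).
  have -> : 2 * (d / 4%:R) = d / 2%:R by field.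
  have -> : 2 * (d / 2%:R) = d by field.
  move=> h1 h2; apply: le_trans h2 _.
  by rewrite expr2 -mulrA ler_wpM2l// ltW.
(* For such y the triangle inequality gives d(y, u0) >= 3d / 4 > d / 4 >= d(y, v). *)
have sub1 : cballI v (d / 4) A `<=` right_part u0 v A.
  apply/fsubsetP => y; rewrite !inE/= => /andP[-> yd]/=.
  have := metric_triangle v y u0; rewrite -/d metric_sym in yd *.
  by move: (metric_sym y v) d0 yd => ->; lra.
have sub2 : v |` T `<=` cballI v d A.
  apply/fsubsetP => y /fset1UP[->|yT].
    by rewrite !inE/= vA mdistxx ltW.
  have := umax [` yT] isT; rewrite /= -/d => yd.
  by move: yT; rewrite !inE/= => /and3P[-> _ _].
(* The point [v], which is not in [T], supplies the extra 1 that turns |A| / 4 into the required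
   (|A| - 1) / 4. *)
have : (#|` T|.+1)%:R < #|` A|%:R / 4 :> R.
  have vT : v \notin T by rewrite !inE/= eqxx andbF.
  have <- : #|` v |` T| = #|` T|.+1 by rewrite cardfsU1 vT.
  apply: (@le_lt_trans _ _ (c ^+ 2 * #|` right_part u0 v A|%:R)).
    apply: (@le_trans _ _ #|` cballI v d A|%:R).
      by rewrite ler_nat fsubset_leq_card.
    apply: le_trans dbl _; apply: ler_wpM2l; first by rewrite exprn_ge0// ltW.
    by rewrite ler_nat fsubset_leq_card.
  have c20 : 0 < c ^+ 2 by rewrite exprn_gt0.
  rewrite -(ltr_pM2l c20) in small.
  apply: lt_le_trans small _; rewrite le_eqVlt; apply/orP; left; apply/eqP.
  by field; rewrite gt_eqF.
have : (0 < #|` A|)%N by rewrite (cardfsD1 v) vA.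
by case: #|` A| => // m _; rewrite -natr1 -[m.+1%:R]natr1 /=; lra.
Qed.

Definition missplit (q xq x1 x2 : X) :=
  (mdist q x1 <= mdist q x2) != (mdist xq x1 <= mdist xq x2).

(** Asymmetric: [x] is the pivot nearer to [q], and [y] lies in the ring of the ball hypothesis for
    [x]. *)
Definition near_tie (q xq x y : X) :=
  (x != xq) && (mdist q x <= mdist q y <= mdist q x + 2 * mdist q xq).

(** Let x be the pivot that [q] follows and y the one that [xq] follows. Then d(q, y) <= d(q, xq) +
    d(xq, y) <= d(q, xq) + d(xq, x) <= d(q, x) + 2 d(q, xq). If x were [xq], then y would have
    distance 0 from [xq] and equal x. *)
Lemma missplit_near_tie q xq x1 x2 : x1 != x2 ->
  missplit q xq x1 x2 -> near_tie q xq x1 x2 || near_tie q xq x2 x1.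
Proof.
rewrite /missplit /near_tie => x12.
have tri (x y : X) : mdist xq y <= mdist xq x ->
    mdist q y <= mdist q x + 2 * mdist q xq.
  move=> yx; have := metric_triangle q xq y; have := metric_triangle xq q x.
  rewrite (metric_sym xq q); lra.
case: leP => q12; case: leP => xq12 // _; apply/orP; [left|right].
  rewrite (tri _ _ (ltW xq12)) ?andbT -mdist_gt0 metric_sym.
  by rewrite (le_lt_trans _ xq12)// mdist_ge0.
rewrite (ltW q12) (tri _ _ xq12) !andbT; apply: contraNneq x12 => x2q.
move: xq12; rewrite x2q mdistxx => h; apply/eqP/mdist_positivity.
by apply/eqP; rewrite eq_le mdist_ge0 metric_sym h.
Qed.

Lemma card_near_tie A q xq x (k : R) : 0 <= k ->
  (x != xq -> #|` cballI q (mdist q x + 2 * mdist q xq) A|%:R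
       <= #|` oballI q (mdist q x) A|%:R + k) ->
  #|` [fset y in A | (x != y) && near_tie q xq x y]|%:R <= k.
Proof.
move=> k0 h; rewrite /near_tie; have [|/h {}h]/= := eqVneq x xq.
  move=> _; rewrite (_ : [fset _ | _ in _ & _] = fset0) ?cardfs0//.
  by apply/fsetP => y; rewrite !inE/= !andbF.
set O := oballI _ _ _ in h; set B := cballI _ _ _ in h.
have OB : O `<=` B.
  apply/fsubsetP => y; rewrite !inE/= => /andP[-> /ltW yx]/=.
  by apply: le_trans yx _; rewrite lerDl mulr_ge0// mdist_ge0.
(* The counted points lie in the closed ball [B] but outside the open ball [O], so they number at
   most |B| - |O|. *)
have /eqP := cardfsDS OB; rewrite -(eqn_add2r #|` O|) subnK ?fsubset_leq_card// => /eqP e.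
apply: (@le_trans _ _ #|` B `\` O|%:R).
  rewrite ler_nat fsubset_leq_card//; apply/fsubsetP => y.
  by rewrite !inE/= => /and4P[-> _ yl ->]; rewrite ltNge yl.
by move: h; rewrite -e natrD addrC lerD2l.
Qed.

End Counting.

(** * Splitting a node stays inside the split closure *)

Section SplitClosure.
Variables (R : realType) (X : metricType R).
Implicit Types (S A : {fset X}).

Lemma split_closure_sub S A : split_closure S A -> A `<=` S.
Proof.
elim=> {A} [|x y _ _|x y _ _|A B _ AS _ _].
- exact: fsubset_refl.
- exact: fset_sub.
- exact: fsubsetDl.
- exact: fsubset_trans (fsubsetIl _ _) AS.
Qed.

(** Cutting [A] by two pivots is intersecting [A] with the cut of all of [S] by the same pivots. *)
Lemma split_closure_left S A x y : split_closure S A -> x \in A -> y \in A ->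
  split_closure S (left_part x y A).
Proof.
move=> SA xA yA; have /fsubsetP AS := split_closure_sub SA.
have -> : left_part x y A = A `&` left_part x y S.
  apply/fsetP => z; rewrite !inE/=; have [zA|//] := boolP (z \in A).
  by rewrite AS.
by apply: SplitI => //; apply: SplitHalf; apply: AS.
Qed.

Lemma split_closure_right S A x y : split_closure S A -> x \in A -> y \in A ->
  split_closure S (right_part x y A).
Proof.
move=> SA xA yA; have /fsubsetP AS := split_closure_sub SA.
have -> : right_part x y A = A `&` (S `\` left_part x y S).
  apply/fsetP => z; rewrite !inE/=; have [zA|//] := boolP (z \in A).
  by rewrite AS// andbT/= ltNge.
by apply: SplitI => //; apply: SplitHalfC; apply: AS.
Qed.

End SplitClosure.

(** * Inequalities for negative powers *)

Section PowerBounds.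
Variable R : realType.
Implicit Types (x y a s : R).

Lemma ler_powRN a x y : 0 <= a -> 0 < x -> x <= y -> y `^ (- a) <= x `^ (- a).
Proof.
move=> a0 x0 xy; have y0 := lt_le_trans x0 xy.
rewrite !powRN lef_pV2 ?posrE ?powR_gt0//.
by apply: ge0_ler_powR; rewrite // nnegrE ltW.
Qed.

(** (1 - s)^(-a) = exp(-a ln(1 - s)) >= 1 - a ln(1 - s) >= 1 + a s. *)
Lemma powRN_shrink a s x : 0 <= a -> 0 <= s < 1 -> 0 < x ->
  (1 + a * s) * x `^ (- a) <= ((1 - s) * x) `^ (- a).
Proof.
move=> a0 /andP[s0 s1] x0.
have s10 : 0 < 1 - s by rewrite subr_gt0.
rewrite powRM ?(ltW s10) ?(ltW x0)//; apply: ler_wpM2r; first exact: powR_ge0.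
rewrite /powR gt_eqF//; apply: le_trans (expR_ge1Dx _).
rewrite lerD2l mulNr -mulrN; apply: ler_wpM2l => //.
by rewrite lerNr; apply: le_ln1Dx; rewrite ltrN2.
Qed.

End PowerBounds.

(** * The potential bounds the failure probability *)

Section SearchFailure.
Variables (R : realType) (X : metricType R) (S : {fset X}) (n0 : nat).
Variables (c : R) (q xq : X) (C alpha : R).
Hypotheses (n0_gt0 : (0 < n0)%N) (C_gt0 : 0 < C).
Hypothesis (expS : expansion_bound S n0 c).
Hypothesis (alphaP : 0 < alpha <= 1).
Hypothesis (ringS : forall A : {fset X}, split_collection S n0 A -> xq \in A ->
   forall x, x \in A -> x != xq ->
   #|` cballI q (mdist q x + 2 * mdist q xq) A|%:R
     <= #|` oballI q (mdist q x) A|%:R + C * #|` A|%:R `^ (1 - alpha)).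
Implicit Types (A B : {fset X}) (t : ctree X).

(** Chosen so that K * alpha * shrink / 2 = 4 C: the mean gain of the potential at a split equals
    the bound on the probability of a missplit. *)
Local Notation K := (32 * C * c ^+ 2 / alpha).
Local Notation shrink := ((4 * c ^+ 2)^-1).

(* The factor 2 makes [fail_potential_le] hold also when [B] has at most [n0]
   points, where the potential is 0. *)
Definition fail_potential A : R :=
  if (n0 < #|` A|)%N
  then K * (2 * n0%:R `^ (- alpha) - #|` A|%:R `^ (- alpha)) else 0.

Let c_ge1 : 1 <= c. Proof. by case: expS. Qed.
Let c_gt0 : 0 < c. Proof. exact: lt_le_trans c_ge1. Qed.
Let alpha_gt0 : 0 < alpha. Proof. by case/andP: alphaP. Qed.
Let K_ge0 : 0 <= K.
Proof.
by rewrite divr_ge0 ?(ltW alpha_gt0)// mulr_ge0 ?exprn_ge0 ?mulr_ge0// ltW.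
Qed.
Let shrinkP : 0 <= shrink < 1.
Proof.
have c2 : 1 <= c ^+ 2 by rewrite exprn_ege1.
by rewrite invr_ge0 invf_lt1; lra.
Qed.

Lemma fail_potential_ge0 A : 0 <= fail_potential A.
Proof.
rewrite /fail_potential; case: ifP => // An0; apply: mulr_ge0 => //.
have n0' : 0 < n0%:R :> R by rewrite ltr0n.
have := @ler_powRN R alpha n0%:R #|` A|%:R (ltW alpha_gt0) n0'.
rewrite ler_nat (ltnW An0) => /(_ isT); have := powR_ge0 (n0%:R : R) (- alpha); lra.
Qed.

Lemma fail_potential_le A B s : (n0 < #|` A|)%N -> 0 <= s < 1 ->
  #|` B|%:R <= (1 - s) * #|` A|%:R ->
  fail_potential B <=
    K * (2 * n0%:R `^ (- alpha) - (1 + alpha * s) * #|` A|%:R `^ (- alpha)).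
Proof.
move=> An0 sP BA; have /andP[s0 s1] := sP; have /andP[_ alpha1] := alphaP.
have n0' : 0 < n0%:R :> R by rewrite ltr0n.
have A0 : 0 < #|` A|%:R :> R by rewrite ltr0n (leq_trans _ An0).
have as1 : alpha * s <= 1 by rewrite mulr_ile1// ltW.
have nA : #|` A|%:R `^ (- alpha) <= n0%:R `^ (- alpha) :> R.
  by apply: ler_powRN => //; rewrite ?ltW// ltr_nat.
have tA0 := powR_ge0 (#|` A|%:R : R) (- alpha).
rewrite /fail_potential; case: ifP => Bn0.
  apply: ler_wpM2l => //; rewrite lerD2l lerN2.
  apply: le_trans (powRN_shrink (ltW alpha_gt0) sP A0) _.
  by apply: ler_powRN => //; rewrite ?ltW// ltr0n (leq_ltn_trans _ Bn0).
(* Here the potential of [B] is 0, and the bound is nonnegative because 1 + alpha s <= 2 and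
   |A|^-alpha <= n0^-alpha. *)
by apply: mulr_ge0 => //; nra.
Qed.

Definition nn_child A x1 x2 :=
  if mdist xq x1 <= mdist xq x2 then left_part x1 x2 A else right_part x1 x2 A.

(** Only points strictly closer to [v] are counted, so the left child of a split contains the set
    counted for its own pivot, whatever happens to ties. *)
Definition small_part A u v := #|` right_part u v A|%:R < #|` A|%:R * shrink.

(** If neither part is small, each child loses at least a fraction [shrink] of [A], since its
    sibling has that many points. Otherwise the child is only known to be no larger than [A], and
    the last term gives back the gain. *)
Lemma fail_potential_child A x1 x2 : (n0 < #|` A|)%N ->
  fail_potential (nn_child A x1 x2) <=
    K * (2 * n0%:R `^ (- alpha) - (1 + alpha * shrink) * #|` A|%:R `^ (- alpha))
    + K * (alpha * shrink) * #|` A|%:R `^ (- alpha)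
      * ((small_part A x1 x2)%:R + (small_part A x2 x1)%:R).
Proof.
move=> An0; have /andP[s0 s1] := shrinkP.
have tA0 := powR_ge0 (#|` A|%:R : R) (- alpha).
have k0 : 0 <= K * (alpha * shrink) * #|` A|%:R `^ (- alpha).
  by rewrite (mulr_ge0 (mulr_ge0 K_ge0 (mulr_ge0 (ltW alpha_gt0) s0))).
have parts : #|` left_part x1 x2 A|%:R + #|` right_part x1 x2 A|%:R
    = #|` A|%:R :> R.
  by rewrite -natrD cardfs_parts.
have [|nsmall] := boolP (small_part A x1 x2 || small_part A x2 x1).
  move=> sm; have sm1 : 1 <= (small_part A x1 x2)%:R + (small_part A x2 x1)%:R :> R.
    by case/orP: sm => ->; rewrite ?lerDl ?lerDr.
  apply: (@le_trans _ _ (K * (2 * n0%:R `^ (- alpha) -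
      (1 + alpha * 0) * #|` A|%:R `^ (- alpha)))).
    apply: fail_potential_le; rewrite ?lexx ?ltr01// subr0 mul1r ler_nat /nn_child.
    by case: ifP => _; apply/fsubset_leq_card/fset_sub.
  have := ler_wpM2l k0 sm1; move: k0; lra.
apply: le_trans (fail_potential_le An0 shrinkP _) _; last first.
  by rewrite lerDl mulr_ge0.
move: nsmall; rewrite negb_or /small_part -!leNgt => /andP[r1 r2].
have : #|` right_part x2 x1 A|%:R <= #|` left_part x1 x2 A|%:R :> R.
  by rewrite ler_nat fsubset_leq_card// sub_right_left_part.
by rewrite /nn_child; case: ifP => _; lra.
Qed.

Lemma pivot_mean_small A : split_collection S n0 A ->
  pivot_mean A (fun u v => (small_part A u v)%:R) <= 4^-1 :> R.
Proof.
move=> SA; have A1 : (1 < #|` A|)%N by apply: leq_ltn_trans (proj2 SA).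
(* The count in [card_small_parts] fixes the second argument [v], so [v] is made the outer
   variable. *)
rewrite -pivot_mean_sym.
have A10 : 0 < (#|` A|).-1%:R :> R by rewrite ltr0n -ltnS prednK// ltnW.
apply: le_trans (pivot_mean_indicator_le (k := (#|` A|).-1%:R / 4) A1 _) _.
  move=> v vA; apply: (card_small_parts c_gt0 _ vA) => r r0.
  exact: (proj2 expS).
by rewrite mulrAC divff ?mul1r// gt_eqF.
Qed.

(** A near tie in a given order has probability at most C |A|^(1 - alpha) / (|A| - 1). The two
    orders give a factor 2, and |A| <= 2 (|A| - 1) gives the other. *)
Lemma pivot_mean_missplit A : split_collection S n0 A -> xq \in A ->
  pivot_mean A (fun x1 x2 => (missplit q xq x1 x2)%:R)
    <= 4 * C * #|` A|%:R `^ (- alpha).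
Proof.
move=> SA xqA; have A1 : (1 < #|` A|)%N by apply: leq_ltn_trans (proj2 SA).
have A10 : 0 < (#|` A|).-1%:R :> R by rewrite ltr0n -ltnS prednK// ltnW.
pose T x1 x2 : R := (near_tie q xq x1 x2)%:R.
apply: (@le_trans _ _ (pivot_mean A (fun x1 x2 => T x1 x2 + T x2 x1))).
  apply: ler_pivot_mean => x1 x2 _ _ x12; rewrite /T -natrD ler_nat.
  have := @missplit_near_tie R X q xq x1 x2 x12.
  by case: missplit => // /(_ isT)/orP[]->; rewrite ?leq_addl ?leq_addr.
rewrite pivot_meanD (pivot_mean_sym A T).
have A0 : 0 < #|` A|%:R :> R by rewrite ltr0n ltnW.
have hT : pivot_mean A T <= C * #|` A|%:R `^ (1 - alpha) / (#|` A|).-1%:R.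
  apply: pivot_mean_indicator_le => // x xA.
  apply: card_near_tie => [|xxq]; last exact: ringS.
  by rewrite mulr_ge0 ?powR_ge0 ?(ltW C_gt0).
apply: le_trans (lerD hT hT) _; rewrite -mulr2n -[leLHS]mulr_natl.
rewrite powRD ?(gt_eqF A0) ?implybT//.
rewrite powRr1 ?(ltW A0)// [leLHS]mulrA ler_pdivrMr//.
have : #|` A|%:R <= 2 * (#|` A|).-1%:R :> R.
  rewrite -natrM ler_nat; case: #|` A| A1 => [|[|n]] //= _.
  by rewrite mul2n -addnn addSn addnS !ltnS leq_addl.
have := mulr_ge0 (ltW C_gt0) (powR_ge0 (#|` A|%:R : R) (- alpha)).
move=> h1 /(ler_wpM2l h1); lra.
Qed.

(** Used to sum out the subtree that the search does not enter. *)
Lemma sum_ctree_pmf_le1 A (J : {fset ctree X}) :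
  \sum_(t <- J) ctree_pmf n0 A t <= 1 :> R.
Proof.
have [n] := ubnP #|` A|; elim: n A J => // n IH A J An.
have [An0|An0] := leqP #|` A| n0.
  apply: le_trans (sum_delta_le (F := fun=> 1) J (Leaf A) _) => //.
  apply: ler_sum => -[B|x1 x2 l r] _ /=; last by rewrite ltnNge An0 mulr1.
  by rewrite An0 mulr1 ler_nat; case: eqVneq => // ->; rewrite eqxx.
have A1 : (1 < #|` A|)%N by apply: leq_ltn_trans An0.
under eq_bigr do rewrite -[ctree_pmf _ _ _]mulr1.
apply: le_trans (sum_ctree_pmf_le J (f := fun=> 1) An0 _) _ => //.
rewrite -[leRHS](pivot_mean_cst 1 A1); apply: ler_pivot_mean => x1 x2 x1A x2A x12.
have [l_lt r_lt] := parts_lt x1A x2A x12.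
under eq_bigr do under eq_bigr do rewrite mulr1.
under eq_bigr do rewrite -mulr_sumr.
rewrite -mulr_suml mulr_ile1 ?sumr_ge0// => *; rewrite ?ctree_pmf_ge0//.
  by apply: IH; apply: leq_trans l_lt _.
by apply: IH; apply: leq_trans r_lt _.
Qed.

Definition search_misses t : R := (xq \notin search_leaf q t)%:R.

(** On a missplit the failure probability is bounded by 1. Otherwise [q] enters the child on the
    side of [xq], and the other subtree has total mass at most 1. *)
Lemma sum_missed_node A x1 x2 (lJ rJ : {fset ctree X}) :
  (forall J : {fset ctree X}, \sum_(t <- J) ctree_pmf n0 (nn_child A x1 x2) t
     * search_misses t <= fail_potential (nn_child A x1 x2)) ->
  \sum_(l <- lJ) \sum_(r <- rJ)
    ctree_pmf n0 (left_part x1 x2 A) l * ctree_pmf n0 (right_part x1 x2 A) r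
      * search_misses (Node x1 x2 l r)
  <= (missplit q xq x1 x2)%:R + fail_potential (nn_child A x1 x2).
Proof.
move: (fail_potential_ge0 (nn_child A x1 x2)).
set p := ctree_pmf n0 (left_part _ _ _); set p' := ctree_pmf n0 (right_part _ _ _).
have p0 t : 0 <= p t by exact: ctree_pmf_ge0.
have p'0 t : 0 <= p' t by exact: ctree_pmf_ge0.
have m0 t : 0 <= search_misses t by rewrite /search_misses.
have sp : \sum_(l <- lJ) p l <= 1 by exact: sum_ctree_pmf_le1.
have sp' : \sum_(r <- rJ) p' r <= 1 by exact: sum_ctree_pmf_le1.
rewrite /missplit => f0 hchild; have [_|/negbNE/eqP ms] := boolP (_ != _).
  rewrite -[leLHS]addr0 lerD//.
  apply: (@le_trans _ _ (\sum_(l <- lJ) p l * \sum_(r <- rJ) p' r)).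
    apply: ler_sum => l _; rewrite mulr_sumr; apply: ler_sum => r _.
    by rewrite -[leRHS]mulr1; apply: ler_wpM2l; rewrite ?mulr_ge0// lern1 leq_b1.
  by rewrite -mulr_suml mulr_ile1 ?sumr_ge0.
rewrite add0r; move: f0 hchild; rewrite /nn_child -ms.
have hN l r : search_misses (Node x1 x2 l r) =
    if mdist q x1 <= mdist q x2 then search_misses l else search_misses r.
  by rewrite /search_misses/=; case: ifP.
move: hN; case: ifP => _ hN f0 hchild.
  apply: (@le_trans _ _ (\sum_(l <- lJ) p l * search_misses l * \sum_(r <- rJ) p' r)).
    apply: ler_sum => l _; rewrite mulr_sumr; apply: ler_sum => r _.
    by rewrite hN mulrAC.
  rewrite -mulr_suml; apply: le_trans (hchild lJ); rewrite -[leRHS]mulr1.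
  by apply: ler_wpM2l => //; rewrite sumr_ge0// => l _; rewrite mulr_ge0.
apply: (@le_trans _ _ (\sum_(l <- lJ) p l * \sum_(r <- rJ) p' r * search_misses r)).
  apply: ler_sum => l _; rewrite mulr_sumr; apply: ler_sum => r _.
  by rewrite hN mulrA.
rewrite -mulr_suml; apply: le_trans (hchild rJ); rewrite -[leRHS]mul1r.
by apply: ler_wpM2r => //; rewrite sumr_ge0// => r _; rewrite mulr_ge0.
Qed.

Lemma sum_missed_le A (J : {fset ctree X}) : split_closure S A -> xq \in A ->
  \sum_(t <- J) ctree_pmf n0 A t * search_misses t <= fail_potential A.
Proof.
have [n] := ubnP #|` A|; elim: n A J => // n IH A J An SA xqA.
have [An0|An0] := leqP #|` A| n0.
  rewrite big1 ?fail_potential_ge0// => -[B|x1 x2 l r] _ /=; last first.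
    by rewrite ltnNge An0 mul0r.
  (* At a leaf the only tree with positive mass is [Leaf A], which contains [xq]. *)
  rewrite /search_misses/=; case: eqVneq => [->|];
    by rewrite ?xqA ?andbF ?mulr0 ?mul0r.
have A1 : (1 < #|` A|)%N by apply: leq_ltn_trans An0.
have SnA : split_collection S n0 A by [].
apply: le_trans (sum_ctree_pmf_le J An0 _) _ => //.
pose B := K * (2 * n0%:R `^ (- alpha) - (1 + alpha * shrink) * #|` A|%:R `^ (- alpha)).
pose k := K * (alpha * shrink) * #|` A|%:R `^ (- alpha).
pose small u v : R := (small_part A u v)%:R.
apply: (@le_trans _ _ (pivot_mean A (fun x1 x2 => (missplit q xq x1 x2)%:R +
    (B + k * (small x1 x2 + small x2 x1))))).
  apply: ler_pivot_mean => x1 x2 x1A x2A x12.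
  have [l_lt r_lt] := parts_lt x1A x2A x12.
  apply: le_trans (lerD (lexx _) (fail_potential_child x1 x2 An0)).
  apply: sum_missed_node => J'; rewrite /nn_child.
  case: (leP (mdist xq x1)) => h; apply: IH; rewrite ?inE/= ?xqA//.
  - exact: leq_trans l_lt _.
  - exact: split_closure_left.
  - exact: leq_trans r_lt _.
  - exact: split_closure_right.
rewrite !pivot_meanD (pivot_mean_cst B A1) pivot_meanZ pivot_meanD.
rewrite (pivot_mean_sym A small) -mulr2n.
have hs := pivot_mean_small SnA; have hm := pivot_mean_missplit SnA xqA.
have k0 : 0 <= k.
  have /andP[s0 _] := shrinkP.
  by rewrite (mulr_ge0 (mulr_ge0 K_ge0 (mulr_ge0 (ltW alpha_gt0) s0))) ?powR_ge0.
have /(ler_wpM2l k0) hk : pivot_mean A small *+ 2 <= 2^-1.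
  by rewrite -mulr_natl; move: hs; rewrite -/small; lra.
apply: le_trans (lerD hm (lerD (lexx B) hk)) _.
(* By the choice of [K] the two sides are equal. *)
rewrite /fail_potential An0 le_eqVlt; apply/orP; left; apply/eqP.
by rewrite /B /k; field; rewrite !gt_eqF.
Qed.

(** Ensures that the returned point lies in [S], where [xq] is the strict minimizer. *)
Lemma search_leaf_sub A t : ctree_pmf n0 A t != 0 :> R -> search_leaf q t `<=` A.
Proof.
elim: t A => [B|x1 x2 l IHl r IHr] A /=.
  by case: (B =P A) => [->|]; rewrite ?fsubset_refl// andbF eqxx.
case: ifP => [_|]; last by rewrite eqxx.
rewrite !mulf_eq0 !negb_or => /and3P[_ /IHl lA /IHr rA].
by case: ifP => _; [apply: fsubset_trans lA _|apply: fsubset_trans rA _];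
  exact: fset_sub.
Qed.

End SearchFailure.

Theorem theorem3 (R : realType) (X : metricType R) (S : {fset X}) (n0 : nat)
  (hn0 : (1 <= n0)%N) (hS : (n0 < #|` S|)%N)
  (c : R) (hc : is_strong_expansion_rate S n0 c)
  (q xq : X) (hq : is_unique_nn S q xq)
  (C alpha : R) (hC : 0 < C) (halpha : 0 < alpha <= 1)
  (hballs : forall A : {fset X}, split_collection S n0 A -> xq \in A ->
     forall x, x \in A -> x != xq ->
     #|` cballI q (mdist q x + 2 * mdist q xq) A|%:R
       <= #|` oballI q (mdist q x) A|%:R + C * #|` A|%:R `^ (1 - alpha))
  (xhat : ctree X -> X)
  (hxhat : forall t, 0 < ctree_pmf n0 S t -> nn_search_output q t (xhat t)) :
  (ctree_prob n0 S [set t | xhat t != xq]%classic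
     <= (360 * C * c ^+ 2 / alpha * n0%:R `^ (- alpha))%:E)%E.
Proof.
have [xqS xq_min] := hq; have [expS _] := hc.
have alpha0 : 0 < alpha by case/andP: halpha.
have c0 : 0 < c by apply: lt_le_trans (proj1 expS).
(* The probability is a supremum of finite sums, so a bound uniform in the finite set [F]
   suffices. *)
apply: ge_ereal_sup => _ [F [finF FE] <-].
rewrite fsbig_finite//= sumEFin lee_fin.
apply: (@le_trans _ _ (\sum_(t <- fset_set F)
    ctree_pmf n0 S t * search_misses q xq t)).
  rewrite big_seq [leRHS]big_seq; apply: ler_sum => t.
  rewrite in_fset_set// inE => /FE /= xhat_ne.
  (* Nothing is assumed about [xhat] on trees of mass 0, but these contribute nothing. *)
  have [->|pt] := eqVneq (ctree_pmf n0 S t) (0 : R); first by rewrite mul0r.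
  have pt0 : 0 < ctree_pmf n0 S t by rewrite lt_def pt ctree_pmf_ge0.
  have [xhat_leaf xhat_nn] := hxhat _ pt0.
  rewrite /search_misses; suff -> : xq \notin search_leaf q t by rewrite mulr1.
  (* If the leaf contained [xq], the output would be no farther from [q] than [xq], contradicting
     uniqueness. *)
  apply/negP => xq_leaf.
  have /fsubsetP/(_ _ xhat_leaf)/xq_min := @search_leaf_sub R X n0 q S t pt.
  by move=> /(_ xhat_ne); rewrite ltNge xhat_nn.
apply: le_trans (sum_missed_le hn0 hC expS halpha hballs _ (SplitRoot S) xqS) _.
(* Dropping the term with |S|^-alpha leaves 2 K n0^-alpha, with constant 64 <= 360. *)
rewrite /fail_potential hS.
have t0 := powR_ge0 (n0%:R : R) (- alpha).
have s0 := powR_ge0 (#|` S|%:R : R) (- alpha).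
have k0 : 0 <= C * c ^+ 2 / alpha.
  by rewrite divr_ge0 ?(ltW alpha0)// mulr_ge0 ?exprn_ge0 ?(ltW c0) ?(ltW hC).
have -> : 32 * C * c ^+ 2 / alpha = 32 * (C * c ^+ 2 / alpha) by rewrite !mulrA.
have -> : 360 * C * c ^+ 2 / alpha = 360 * (C * c ^+ 2 / alpha) by rewrite !mulrA.
have := mulr_ge0 k0 t0; have := mulr_ge0 k0 s0; lra.
Qed.
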